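(* Let $A$ be a Hermitian Banach $*$-algebra and let $a,b\in A$ be positive. Then the product $ab$ is positive if and only if $ab=ba$.
   Context: All algebras are complex. A Banach $*$-algebra is a complete complex algebra with an involution $a\mapsto a^*$ (conjugate linear, $(ab)^*=b^*a^*$, $a^{**}=a$) and a norm with $|ab|\le|a||b|$; the involution need not be continuous. $\widetilde A$ is $A$ if unital, otherwise $A$ with a unit $e$ adjoined, and $\mathrm{sp}(a)=\{\lambda:\lambda e-a\text{ not invertible in }\widetilde A\}$. $A$ is Hermitian if every Hermitian element ($a=a^*$) has real spectrum. An element $a$ is positive if $a=a^*$ and $\mathrm{sp}(a)\subset[0,\infty)$. *)

(* Defs.v *)
From Stdlib Require Import Reals Classical.
Open Scope R_scope.

Record C := mkC { Re : R; Im : R }.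

Definition Cadd (z w : C) : C := mkC (Re z + Re w) (Im z + Im w).
Definition Cmul (z w : C) : C :=
  mkC (Re z * Re w - Im z * Im w) (Re z * Im w + Im z * Re w).
Definition Copp (z : C) : C := mkC (- Re z) (- Im z).
Definition Cconj (z : C) : C := mkC (Re z) (- Im z).
Definition Cmod (z : C) : R := sqrt (Re z * Re z + Im z * Im z).
Definition C0 : C := mkC 0 0.
Definition C1 : C := mkC 1 0.

(** * Banach *-algebras (complex, involution not assumed continuous) *)
Record BanachStarAlgebra := {
  car :> Type;
  zero : car;
  add : car -> car -> car;
  opp : car -> car;
  scal : C -> car -> car;
  mul : car -> car -> car;
  star : car -> car;
  norm : car -> R;
  add_assoc : forall x y z, add x (add y z) = add (add x y) z;
  add_comm : forall x y, add x y = add y x;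
  add_zero : forall x, add x zero = x;
  add_opp : forall x, add x (opp x) = zero;
  scal_assoc : forall a b x, scal a (scal b x) = scal (Cmul a b) x;
  scal_one : forall x, scal C1 x = x;
  scal_distr_l : forall a x y, scal a (add x y) = add (scal a x) (scal a y);
  scal_distr_r : forall a b x, scal (Cadd a b) x = add (scal a x) (scal b x);
  mul_assoc : forall x y z, mul x (mul y z) = mul (mul x y) z;
  mul_add_l : forall x y z, mul (add x y) z = add (mul x z) (mul y z);
  mul_add_r : forall x y z, mul x (add y z) = add (mul x y) (mul x z);
  mul_scal_l : forall a x y, mul (scal a x) y = scal a (mul x y);
  mul_scal_r : forall a x y, mul x (scal a y) = scal a (mul x y);
  norm_nonneg : forall x, 0 <= norm x;
  norm_eq0 : forall x, norm x = 0 -> x = zero;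
  norm_triangle : forall x y, norm (add x y) <= norm x + norm y;
  norm_scal : forall a x, norm (scal a x) = Cmod a * norm x;
  norm_mul : forall x y, norm (mul x y) <= norm x * norm y;
  complete : forall u : nat -> car,
    (forall eps, 0 < eps -> exists N, forall m n, (N <= m)%nat -> (N <= n)%nat ->
        norm (add (u m) (opp (u n))) < eps) ->
    exists l, forall eps, 0 < eps -> exists N, forall n, (N <= n)%nat ->
        norm (add (u n) (opp l)) < eps;
  star_add : forall x y, star (add x y) = add (star x) (star y);
  star_scal : forall a x, star (scal a x) = scal (Cconj a) (star x);
  star_mul : forall x y, star (mul x y) = mul (star y) (star x);
  star_invol : forall x, star (star x) = x
}.

Section Spectral.
Variable A : BanachStarAlgebra.

Definition sub (x y : A) : A := add A x (opp A y).

Definition is_unit_elem (e : A) : Prop :=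
  forall x : A, mul A e x = x /\ mul A x e = x.

Definition unital : Prop := exists e : A, is_unit_elem e.

(** [lambda e - a] is invertible in the unitization Ã:
    if A is unital, Ã = A; otherwise Ã = C ⊕ A with
    (λ, x)(μ, y) = (λμ, λy + μx + xy) and unit (1, 0). *)
Definition tilde_invertible (lam : C) (a : A) : Prop :=
  (exists e : A, is_unit_elem e /\
     exists b : A,
       mul A (sub (scal A lam e) a) b = e /\ mul A b (sub (scal A lam e) a) = e)
  \/
  (~ unital /\
     exists (mu : C) (b : A),
       Cmul lam mu = C1 /\
       add A (add A (scal A lam b) (scal A mu (opp A a))) (mul A (opp A a) b) = zero A /\
       add A (add A (scal A mu (opp A a)) (scal A lam b)) (mul A b (opp A a)) = zero A).

Definition in_spectrum (a : A) (lam : C) : Prop := ~ tilde_invertible lam a.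

Definition hermitian_elem (a : A) : Prop := star A a = a.

Definition hermitian_algebra : Prop :=
  forall a : A, hermitian_elem a -> forall lam, in_spectrum a lam -> Im lam = 0.

Definition positive_elem (a : A) : Prop :=
  hermitian_elem a /\
  forall lam, in_spectrum a lam -> Im lam = 0 /\ 0 <= Re lam.

End Spectral.

(* Main.v *)
(** If [a b] is positive it is self-adjoint, so [a b = b a]. Conversely let [a], [b] commute. Inside the bicommutant of [{a, b}], with a unit adjoined, everything commutes and inverses are retained, so the question is one about a commutative normed algebra. There a sum of positive elements is positive: for large [M] the elements [M - a] and [M - b] have spectral radius at most [M], hence [2 M - a - b] has spectral radius at most [2 M]. If moreover [a] is invertible then [a b + lam = a (b + lam a^-1)] with [b + lam a^-1] a sum of positive elements, one of them bounded away from 0. The general case follows by perturbing [a] to [a + e]; the Hermitian hypothesis is what makes the spectrum of [(a + e) b] real. Neither characters nor square roots are needed. *)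

From Stdlib Require Import Reals Classical ClassicalEpsilon ProofIrrelevance.
From Stdlib Require Import Wf_nat Lra Lia.
From Coquelicot Require Compactness Complex.
Require Import Defs.

(** * Arithmetic and modulus of complex numbers *)

Lemma C_eq (z w : C) : Re z = Re w -> Im z = Im w -> z = w.
Proof. destruct z, w; simpl; congruence. Qed.

Ltac C_ring := apply C_eq; simpl; ring.

Definition RC (r : R) : C := mkC r 0.

Definition Cinv (z : C) : C :=
  mkC (Re z / (Re z * Re z + Im z * Im z)) (- Im z / (Re z * Re z + Im z * Im z)).

Lemma Cnorm_pos (z : C) : z <> C0 -> 0 < Re z * Re z + Im z * Im z.
Proof.
  intro Hz. destruct (Req_dec (Re z) 0) as [E|E]; destruct (Req_dec (Im z) 0) as [F|F]; try nra.
  exfalso; apply Hz; apply C_eq; assumption.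
Qed.

Lemma Cmul_inv (z : C) : z <> C0 -> Cmul z (Cinv z) = C1.
Proof. intro Hz. apply Cnorm_pos in Hz. apply C_eq; simpl; field; lra. Qed.

Lemma Cmod_RC (r : R) : Cmod (RC r) = Rabs r.
Proof.
  unfold Cmod, RC; simpl. replace (r * r + 0 * 0) with (Rsqr r) by (unfold Rsqr; ring).
  apply sqrt_Rsqr_abs.
Qed.

Lemma Rabs_neg_one : Rabs (-1) = 1.
Proof. rewrite Rabs_left; lra. Qed.

Lemma Cmod_nonneg (z : C) : 0 <= Cmod z.
Proof. apply sqrt_pos. Qed.

Lemma Cmod_le_abs (z : C) : Cmod z <= Rabs (Re z) + Rabs (Im z).
Proof.
  pose proof (Rabs_pos (Re z)). pose proof (Rabs_pos (Im z)).
  unfold Cmod.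
  rewrite <- (sqrt_Rsqr (Rabs (Re z) + Rabs (Im z))) by lra.
  apply sqrt_le_1_alt.
  assert (H1 : Rabs (Re z) * Rabs (Re z) = Re z * Re z) by (rewrite <- Rabs_mult; apply Rabs_pos_eq; nra).
  assert (H2 : Rabs (Im z) * Rabs (Im z) = Im z * Im z) by (rewrite <- Rabs_mult; apply Rabs_pos_eq; nra).
  unfold Rsqr. nra.
Qed.

Lemma Cmod_coquelicot (z : C) : Cmod z = Complex.Cmod (Re z, Im z).
Proof. unfold Cmod, Complex.Cmod; simpl. f_equal; ring. Qed.

Lemma Cmod_add (z w : C) : Cmod (Cadd z w) <= Cmod z + Cmod w.
Proof.
  rewrite !Cmod_coquelicot. exact (Complex.Cmod_triangle (Re z, Im z) (Re w, Im w)).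
Qed.

Lemma Cmod_mul (z w : C) : Cmod (Cmul z w) = Cmod z * Cmod w.
Proof.
  rewrite !Cmod_coquelicot, <- Complex.Cmod_mult. reflexivity.
Qed.

(** For [u <> -1] the root is [(1 + u) / |1 + u|], where [|1 + u|^2 = 2 + 2 c] with [c] the real
    part of [u]; for [u = -1] it is the imaginary unit. *)
Lemma unit_circle_sqrt (u : C) : Cmod u = 1 -> exists v, Cmod v = 1 /\ Cmul v v = u.
Proof.
  intro Hu. destruct u as [c d]. unfold Cmod in *; simpl in *.
  assert (Hcd : c * c + d * d = 1).
  { rewrite <- (sqrt_sqrt (c * c + d * d)) by nra. rewrite Hu; ring. }
  destruct (Req_dec c (-1)) as [E|E].
  - exists (mkC 0 1). assert (d = 0) by nra. subst. split.
    + simpl. replace (0 * 0 + 1 * 1) with 1 by ring. apply sqrt_1.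
    + apply C_eq; simpl; ring.
  - assert (Hc : 0 < 2 + 2 * c) by nra.
    pose proof (sqrt_lt_R0 _ Hc) as Hn. pose proof (sqrt_sqrt (2 + 2 * c) ltac:(lra)) as Hnn.
    set (n := sqrt (2 + 2 * c)) in *.
    exists (mkC ((1 + c) / n) (d / n)).
    assert (E1 : (1 + c) / n * ((1 + c) / n) = (1 + c) * (1 + c) / (2 + 2 * c)) by (rewrite <- Hnn; field; lra).
    assert (E2 : d / n * (d / n) = d * d / (2 + 2 * c)) by (rewrite <- Hnn; field; lra).
    assert (E3 : (1 + c) / n * (d / n) = (1 + c) * d / (2 + 2 * c)) by (rewrite <- Hnn; field; lra).
    split.
    + simpl. rewrite E1, E2. replace (d * d) with (1 - c * c) by lra.
      replace (_ + _) with 1 by (field; lra). apply sqrt_1.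
    + apply C_eq; simpl.
      * rewrite E1, E2. replace (d * d) with (1 - c * c) by lra. field; lra.
      * rewrite (Rmult_comm (d / n)), E3. field; lra.
Qed.

(* Completeness enters only through [near_one_inv]; dropping it lets subalgebras that are closed under inverses be instances without a closure argument. *)
Record InvNormedAlgebra := {
  elt :> Type;
  rzero : elt;
  rone : elt;
  radd : elt -> elt -> elt;
  rmul : elt -> elt -> elt;
  rsub : elt -> elt -> elt;
  ropp : elt -> elt;
  alg_ring : ring_theory rzero rone radd rmul rsub ropp eq;
  emb : C -> elt;
  emb_one : emb C1 = rone;
  emb_add : forall z w, emb (Cadd z w) = radd (emb z) (emb w);
  emb_mul : forall z w, emb (Cmul z w) = rmul (emb z) (emb w);
  nrm : elt -> R;
  nrm_nonneg : forall x, 0 <= nrm x;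
  nrm_one : nrm rone <= 1;
  nrm_add : forall x y, nrm (radd x y) <= nrm x + nrm y;
  nrm_mul : forall x y, nrm (rmul x y) <= nrm x * nrm y;
  nrm_scal : forall z x, nrm (rmul (emb z) x) <= Cmod z * nrm x;
  near_one_inv : forall x, nrm x < 1 -> exists y, rmul (rsub rone x) y = rone
}.

Declare Scope alg_scope.
Delimit Scope alg_scope with A.

(** * Scalars, norms and inverses in a commutative normed algebra *)

Section CommutativeAlgebra.
Context (B : InvNormedAlgebra).

Local Notation "0" := (rzero B) : alg_scope.
Local Notation "1" := (rone B) : alg_scope.
Local Notation "x + y" := (radd B x y) : alg_scope.
Local Notation "x * y" := (rmul B x y) : alg_scope.
Local Notation "x - y" := (rsub B x y) : alg_scope.
Local Notation "- x" := (ropp B x) : alg_scope.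
Local Notation re r := (emb B (RC r)).

Add Ring alg_ring_tac : (alg_ring B).

Lemma re_one : (re 1 = 1)%A.
Proof. exact (emb_one B). Qed.

Lemma re_add (r s : R) : (re (r + s)%R = re r + re s)%A.
Proof. rewrite <- emb_add. f_equal. C_ring. Qed.

Lemma re_mul (r s : R) : (re (r * s)%R = re r * re s)%A.
Proof. rewrite <- emb_mul. f_equal. C_ring. Qed.

Lemma re_zero : (re 0 = 0)%A.
Proof.
  assert (H : (re 0 = re 0 + re 0)%A) by (rewrite <- re_add; do 2 f_equal; ring).
  transitivity (re 0 + re 0 - re 0)%A; [ring | rewrite <- H; ring].
Qed.

Lemma re_opp (r : R) : (re (- r)%R = - re r)%A.
Proof.
  transitivity (re (- r)%R + re r - re r)%A; [ring|].
  rewrite <- re_add. replace (- r + r)%R with 0%R by ring. rewrite re_zero. ring.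
Qed.

Lemma re_neg_one : (re (-1) = - (1))%A.
Proof. replace (-1)%R with (- (1))%R by ring. rewrite re_opp, re_one. reflexivity. Qed.

Lemma re_sub (r s : R) : (re (r - s)%R = re r - re s)%A.
Proof. unfold Rminus. rewrite re_add, re_opp. ring. Qed.

Lemma re_inv (r : R) : (r <> 0)%R -> (re r * re (/ r)%R = 1)%A.
Proof. intro H. rewrite <- re_mul, Rinv_r by exact H. exact re_one. Qed.

Lemma nrm_re (r : R) (x : B) : (nrm B (re r * x)%A <= Rabs r * nrm B x).
Proof. rewrite <- Cmod_RC. apply nrm_scal. Qed.

Lemma nrm_zero : nrm B 0%A = 0%R.
Proof.
  apply Rle_antisym; [|apply nrm_nonneg].
  replace 0%A with (re 0 * 0)%A by ring.
  eapply Rle_trans; [apply nrm_re|]. rewrite Rabs_R0. lra.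
Qed.

Lemma nrm_opp (x : B) : nrm B (- x)%A = nrm B x.
Proof.
  assert (H : forall y, nrm B (- y)%A <= nrm B y).
  { intro y. replace (- y)%A with (re (-1) * y)%A by (rewrite re_neg_one; ring).
    eapply Rle_trans; [apply nrm_re|]. rewrite Rabs_neg_one. lra. }
  apply Rle_antisym; [apply H|]. replace x with (- - x)%A at 1 by ring. apply H.
Qed.

Lemma nrm_sub (x y : B) : nrm B (x - y)%A <= nrm B x + nrm B y.
Proof.
  replace (x - y)%A with (x + - y)%A by ring. rewrite <- (nrm_opp y). apply nrm_add.
Qed.

Definition inv (x : B) : Prop := exists y, (x * y = 1)%A.

Lemma inv_mul (x y : B) : inv x -> inv y -> inv (x * y)%A.
Proof.
  intros [x' Hx] [y' Hy]. exists (x' * y')%A.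
  transitivity ((x * x') * (y * y'))%A; [ring | rewrite Hx, Hy; ring].
Qed.

Lemma inv_factor (x y : B) : inv (x * y)%A -> inv x.
Proof. intros [z Hz]. exists (y * z)%A. rewrite <- Hz. ring. Qed.

Lemma inv_opp (x : B) : inv x -> inv (- x)%A.
Proof. intros [y Hy]. exists (- y)%A. rewrite <- Hy. ring. Qed.

Lemma inv_emb (z : C) : z <> C0 -> inv (emb B z).
Proof. intro Hz. exists (emb B (Cinv z)). rewrite <- emb_mul, Cmul_inv by exact Hz. apply emb_one. Qed.

Lemma inv_re (r : R) : r <> 0%R -> inv (re r).
Proof. intro Hr. apply inv_emb. intro E. apply Hr. exact (f_equal Re E). Qed.

(** The identity [y = 1 + x y] gives [|y| <= 1 + |y| / 2]. *)
Lemma near_one_inverse_bound (x : B) : nrm B x <= 1 / 2 ->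
  exists y, ((1 - x) * y = 1)%A /\ nrm B y <= 2.
Proof.
  intro Hx. destruct (near_one_inv B x) as [y Hy]; [lra|]. exists y. split; [exact Hy|].
  assert (E : (y = 1 + x * y)%A) by (rewrite <- Hy; ring).
  pose proof (nrm_nonneg B y). pose proof (nrm_one B).
  pose proof (nrm_add B 1%A (x * y)%A) as H1. rewrite <- E in H1.
  pose proof (nrm_mul B x y). nra.
Qed.

(** Factor [x + h = x (1 + h y)] and invert the second factor. *)
Lemma near_inverse_bound (x y h : B) : (x * y = 1)%A -> nrm B h * nrm B y <= 1 / 2 ->
  exists y', ((x + h) * y' = 1)%A /\ nrm B y' <= 2 * nrm B y.
Proof.
  intros Hy Hh. destruct (near_one_inverse_bound (- (h * y))%A) as [w [Hw Hn]].
  { rewrite nrm_opp. eapply Rle_trans; [apply nrm_mul | exact Hh]. }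
  exists (y * w)%A. split.
  - rewrite <- Hw. transitivity ((x * y) * w + h * y * w)%A; [ring | rewrite Hy; ring].
  - eapply Rle_trans; [apply nrm_mul|]. pose proof (nrm_nonneg B y). nra.
Qed.

(** * Uniform bounds for resolvents on a compact square *)

Definition in_square (r : R) (z : C) : Prop := Rabs (Re z) <= r /\ Rabs (Im z) <= r.

(** One number [d] is both the radius of the neighbourhood and the reciprocal of the bound, so that
    a single lower bound on [d], supplied by compactness, controls both. *)
Lemma resolvent_locally_bounded (x : B) (z : C) : inv (1 - emb B z * x)%A ->
  exists d : posreal, forall w, Rabs (Re w - Re z) < d -> Rabs (Im w - Im z) < d ->
    exists y, ((1 - emb B w * x) * y = 1)%A /\ nrm B y <= / d.
Proof.
  intros [y Hy].
  pose proof (nrm_nonneg B x) as Nx. pose proof (nrm_nonneg B y) as Ny.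
  (* With [D] this product, a shift [h] with [|h| <= 2 / D] satisfies [|h x| |y| <= 1/2], and the
     resulting bound [2 |y|] is below [D]. *)
  assert (Hp : (0 < 4 * (nrm B x + 1) * (nrm B y + 1))%R) by nra.
  exists (mkposreal _ (Rinv_0_lt_compat _ Hp)). simpl. intros w Hr Hi.
  set (D := (4 * (nrm B x + 1) * (nrm B y + 1))%R) in *.
  set (h := Cadd z (Cmul (RC (-1)) w)).
  destruct (near_inverse_bound _ _ (emb B h * x)%A Hy) as [y' [Hy' Hn]].
  - assert (Hh : Cmod h <= 2 * / D).
    { eapply Rle_trans; [apply Cmod_le_abs|].
      replace (Re h) with (- (Re w - Re z))%R by (unfold h; simpl; ring).
      replace (Im h) with (- (Im w - Im z))%R by (unfold h; simpl; ring).
      rewrite !Rabs_Ropp. lra. }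
    pose proof (nrm_scal B h x) as Hs. pose proof (Rinv_0_lt_compat _ Hp) as HD.
    assert (HD1 : (D * / D = 1)%R) by (apply Rinv_r; lra).
    assert (H1 : nrm B (emb B h * x)%A <= 2 * / D * nrm B x) by nra.
    assert (H2 : nrm B (emb B h * x)%A * nrm B y <= / D * (2 * nrm B x * nrm B y)) by nra.
    assert (H3 : (2 * nrm B x * nrm B y <= D / 2)%R) by (unfold D; nra).
    assert (H4 : / D * (2 * nrm B x * nrm B y) <= / D * (D / 2)) by (apply Rmult_le_compat_l; lra).
    lra.
  - exists y'. split.
    + refine (eq_trans _ Hy'). unfold h. rewrite emb_add, emb_mul, re_neg_one. ring.
    + rewrite Rinv_inv. unfold D. nra.
Qed.

Lemma resolvent_bounded (x : B) (r : R) :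
  (forall z, in_square r z -> inv (1 - emb B z * x)%A) ->
  exists K, 0 < K /\ forall z, in_square r z ->
    exists y, ((1 - emb B z * x) * y = 1)%A /\ nrm B y <= K.
Proof.
  intro H.
  assert (Hd : forall u v, exists d : posreal, in_square r (mkC u v) ->
      forall w, Rabs (Re w - u) < d -> Rabs (Im w - v) < d ->
      exists y, ((1 - emb B w * x) * y = 1)%A /\ nrm B y <= / d).
  { intros u v. destruct (classic (in_square r (mkC u v))) as [S|S].
    - destruct (resolvent_locally_bounded x _ (H _ S)) as [d Hd]. exists d. intros _. exact Hd.
    (* A dummy value: only centres inside the square are ever consulted. *)
    - exists (mkposreal _ Rlt_0_1). intro S'. contradiction. }
  pose (delta u v := proj1_sig (constructive_indefinite_description _ (Hd u v))).
  destruct (Compactness.compactness_value_2d (- r) r (- r) r delta) as [d Hc].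
  exists (/ d). split; [apply Rinv_0_lt_compat, d|].
  (* The compactness lemma yields its centre only under a double negation, so the goal is put in the
     same form. *)
  intros z [Hz1 Hz2]. apply NNPP. intro Hn.
  apply (Hc (Re z) (Im z)); [revert Hz1; unfold Rabs; case Rcase_abs; lra | revert Hz2; unfold Rabs; case Rcase_abs; lra |].
  intros (u & v & Hu & Hv & Du & Dv & Hdd). apply Hn.
  unfold delta in *.
  destruct (constructive_indefinite_description _ (Hd u v)) as [e He]; simpl in *.
  destruct (He) with (w := z) as [y [Hy Ny]]; [| exact Du | exact Dv |].
  - split; simpl; unfold Rabs; case Rcase_abs; lra.
  - exists y. split; [exact Hy|]. eapply Rle_trans; [exact Ny|].
    apply Rinv_le_contravar; [apply d | exact Hdd].
Qed.

Lemma in_square_polar (r s : R) (u : C) : Cmod u = 1%R -> 0 <= s <= r ->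
  in_square r (Cmul u (RC s)).
Proof.
  intros Hu Hs. unfold Cmod in Hu.
  assert (E : (Re u * Re u + Im u * Im u = 1)%R).
  { rewrite <- (sqrt_sqrt (Re u * Re u + Im u * Im u)) by nra. rewrite Hu; ring. }
  split; simpl; apply Rabs_le; nra.
Qed.

(** * The powers [p^(2^m)] and the spectral radius *)

Fixpoint sq (m : nat) (p : B) : B :=
  match m with O => p | S m => (sq m p * sq m p)%A end.

(* The mean of [(1 - p)^-1] and [(1 + p)^-1] is [(1 - p^2)^-1], so the modulus of continuity of [s |-> (1 - (s x)^(2^m))^-1] does not depend on [m]. *)
Lemma doubled_resolvents_equicontinuous (x : B) (r K s s' : R) :
  (forall z, in_square r z -> exists y, ((1 - emb B z * x) * y = 1)%A /\ nrm B y <= K) ->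
  0 <= s <= r -> 0 <= s' <= r ->
  forall m u, Cmod u = 1%R ->
  exists y y', ((1 - emb B u * sq m (re s * x)) * y = 1)%A /\
    ((1 - emb B u * sq m (re s' * x)) * y' = 1)%A /\
    nrm B (y' - y)%A <= Rabs (s' - s) * (nrm B x * (K * K)).
Proof.
  intros HK Hs Hs'. induction m as [|m IH]; intros u Hu.
  - destruct (HK _ (in_square_polar _ _ u Hu Hs)) as [y [Hy Ny]].
    destruct (HK _ (in_square_polar _ _ u Hu Hs')) as [y' [Hy' Ny']].
    rewrite emb_mul in Hy, Hy'.
    exists y, y'. simpl.
    split; [refine (eq_trans _ Hy); ring | split; [refine (eq_trans _ Hy'); ring|]].
    (* The resolvent identity. *)
    assert (E : (y' - y = re (s' - s)%R * (emb B u * (x * (y * y'))))%A).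
    { rewrite re_sub.
      transitivity (y' * ((1 - emb B u * re s * x) * y) - y * ((1 - emb B u * re s' * x) * y'))%A;
        [rewrite Hy, Hy'; ring | ring]. }
    rewrite E. eapply Rle_trans; [apply nrm_re|].
    apply Rmult_le_compat_l; [apply Rabs_pos|].
    eapply Rle_trans; [apply nrm_scal|]. rewrite Hu, Rmult_1_l.
    eapply Rle_trans; [apply nrm_mul|].
    apply Rmult_le_compat_l; [apply nrm_nonneg|].
    eapply Rle_trans; [apply nrm_mul|].
    apply Rmult_le_compat; auto using nrm_nonneg.
  (* With [v^2 = u], the factors of [1 - u q^2] are [1 - v q] and [1 + v q]; this is why the
     statement ranges over the whole unit circle. Averaging two differences with weight 1/2 leaves
     the bound unchanged. *)
  - destruct (unit_circle_sqrt u Hu) as [v [Hv Hvv]].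
    destruct (IH v Hv) as (y1 & y1' & H1 & H1' & N1).
    destruct (IH (Cmul (RC (-1)) v)) as (y2 & y2' & H2 & H2' & N2).
    { rewrite Cmod_mul, Hv, Cmod_RC, Rabs_neg_one. ring. }
    rewrite emb_mul, re_neg_one in H2, H2'.
    assert (Hh : (re (/ 2) + re (/ 2) = 1)%A).
    { rewrite <- re_add, <- re_one. do 2 f_equal. lra. }
    assert (Mean : forall q z1 z2, ((1 - emb B v * q) * z1 = 1)%A ->
      ((1 - - (1) * emb B v * q) * z2 = 1)%A ->
      ((1 - emb B u * (q * q)) * (re (/ 2) * (z1 + z2)) = 1)%A).
    { intros q z1 z2 E1 E2. rewrite <- Hvv, emb_mul.
      transitivity (re (/ 2) * ((1 + emb B v * q) * ((1 - emb B v * q) * z1)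
        + (1 - emb B v * q) * ((1 - - (1) * emb B v * q) * z2)))%A; [ring|].
      rewrite E1, E2. refine (eq_trans _ Hh). ring. }
    exists (re (/ 2) * (y1 + y2))%A, (re (/ 2) * (y1' + y2'))%A. simpl.
    split; [apply Mean; assumption | split; [apply Mean; assumption|]].
    replace (_ - _)%A with (re (/ 2) * ((y1' - y1) + (y2' - y2)))%A by ring.
    eapply Rle_trans; [apply nrm_re|]. rewrite Rabs_pos_eq by lra.
    pose proof (nrm_add B (y1' - y1)%A (y2' - y2)%A). lra.
Qed.

Lemma sq_scal (t : R) (p : B) (m : nat) :
  sq m (re t * p)%A = (re (t ^ (2 ^ m))%R * sq m p)%A.
Proof.
  induction m as [|m IH]; simpl.
  - rewrite Rmult_1_r. reflexivity.
  - rewrite IH. rewrite Nat.add_0_r, pow_add, re_mul. ring.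
Qed.

Lemma sq_add (m k : nat) (p : B) : sq (k + m) p = sq k (sq m p).
Proof. induction k as [|k IH]; simpl; [|rewrite IH]; reflexivity. Qed.

Lemma nrm_sq_le_one (p : B) (k : nat) : nrm B p <= 1 -> nrm B (sq k p) <= 1.
Proof.
  intro H. induction k as [|k IH]; simpl; [exact H|].
  eapply Rle_trans; [apply nrm_mul|]. pose proof (nrm_nonneg B (sq k p)). nra.
Qed.

(** Since [p = (y - 1) - p (y - 1)], one has [|p| <= e + e |p|]. This and the next lemma trade
    smallness of [p] for closeness of its resolvent to 1. *)
Lemma small_of_inverse_near_one (p y : B) (e : R) : e < 1 ->
  ((1 - p) * y = 1)%A -> nrm B (y - 1)%A <= e -> nrm B p * (1 - e) <= e.
Proof.
  intros He Hy Hn.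
  assert (E : (p = (y - 1) - p * (y - 1))%A).
  { symmetry. transitivity ((1 - p) * y - 1 + p)%A; [ring | rewrite Hy; ring]. }
  pose proof (nrm_sub (y - 1)%A (p * (y - 1))%A) as H1. rewrite <- E in H1.
  pose proof (nrm_mul B p (y - 1)%A). pose proof (nrm_nonneg B p). nra.
Qed.

Lemma inverse_near_one_of_small (p y : B) :
  ((1 - p) * y = 1)%A -> nrm B p <= 1 / 5 -> nrm B (y - 1)%A <= 1 / 4.
Proof.
  intros Hy Hp.
  assert (E : (y - 1 = p + p * (y - 1))%A).
  { transitivity (y - (1 - p) * y)%A; [rewrite Hy; reflexivity | ring]. }
  pose proof (nrm_add B p (p * (y - 1))%A) as H1. rewrite <- E in H1.
  pose proof (nrm_mul B p (y - 1)%A). pose proof (nrm_nonneg B (y - 1)%A). nra.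
Qed.

(** Further squarings keep the norm at most 1, while the scalar [t^(2^(k + m))] tends to 0. *)
Lemma sq_small_of_le_one (p : B) (m : nat) (t : R) : 0 <= t < 1 ->
  nrm B (sq m p) <= 1 -> exists k, nrm B (sq k (re t * p)%A) <= 1 / 5.
Proof.
  intros Ht Hp.
  destruct (pow_lt_1_zero t) with (y := (1 / 5)%R) as [k Hk]; [rewrite Rabs_pos_eq; lra | lra |].
  exists (k + m)%nat. rewrite sq_scal, sq_add.
  eapply Rle_trans; [apply nrm_re|].
  pose proof (nrm_sq_le_one _ k Hp). pose proof (nrm_nonneg B (sq k (sq m p))).
  pose proof (Rabs_pos (t ^ 2 ^ (k + m))).
  assert (Hl : (2 ^ (k + m) >= k)%nat).
  { pose proof (Nat.pow_gt_lin_r 2 (k + m)). lia. }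
  specialize (Hk _ Hl). nra.
Qed.

(* This replaces Gelfand's spectral radius formula. *)
Lemma sq_small_of_resolvent (x : B) (r : R) : 0 < r ->
  (forall z, in_square r z -> inv (1 - emb B z * x)%A) ->
  forall s, 0 <= s < r -> exists m, nrm B (sq m (re s * x)%A) <= 1 / 5.
Proof.
  intros Hr H. destruct (resolvent_bounded x r H) as (K & HK & HB).
  pose proof (nrm_nonneg B x) as Nx.
  set (L := (nrm B x * (K * K))%R).
  assert (HL : 0 <= L) by (unfold L; apply Rmult_le_pos; nra).
  (* [L] is a Lipschitz constant, the same for all [m]; over a distance [d] the resolvents move by
     at most 1/4. *)
  set (d := (/ (4 * (L + 1)))%R).
  assert (Hd : 0 < d) by (apply Rinv_0_lt_compat; lra).
  assert (HdL : (d * L <= 1 / 4)%R).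
  { assert ((d * (4 * (L + 1)) = 1)%R) by (apply Rinv_l; lra). nra. }
  (* Continuation in [s]. A power that is small at [s0 < s] has resolvent within 1/4 of 1; at
     [s1 > s], with the same [m], the resolvent is within 1/2 of 1, so the power has norm at most 1.
     Shrinking by [s / s1 < 1] makes a higher power small at [s]. *)
  assert (Step : forall s, 0 <= s < r -> (s > 0 -> exists m, nrm B (sq m (re (Rmax 0 (s - d / 2)) * x)%A) <= 1 / 5) ->
     exists m, nrm B (sq m (re s * x)%A) <= 1 / 5).
  { intros s Hs IH. destruct (Req_dec s 0) as [E|E].
    - exists 0%nat. simpl. subst s. rewrite re_zero. replace (0 * x)%A with 0%A by ring.
      rewrite nrm_zero. lra.
    - destruct IH as [m Hm]; [lra|].
      set (s0 := Rmax 0 (s - d / 2)) in *. set (s1 := Rmin r (s + d / 2)).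
      assert (Hs0 : 0 <= s0 < s) by (unfold s0, Rmax; destruct Rle_dec; lra).
      assert (Hs1 : s < s1 <= r) by (unfold s1, Rmin; destruct Rle_dec; lra).
      assert (Hd1 : s1 - s0 <= d) by (unfold s1, s0, Rmin, Rmax; destruct Rle_dec; destruct Rle_dec; lra).
      destruct (doubled_resolvents_equicontinuous x r K s0 s1 HB ltac:(lra) ltac:(lra) m C1)
        as (y & y' & Hy & Hy' & Ny); [change C1 with (RC 1); rewrite Cmod_RC; apply Rabs_R1|].
      rewrite emb_one in Hy, Hy'.
      replace (1 * sq m (re s0 * x))%A with (sq m (re s0 * x)%A) in Hy by ring.
      replace (1 * sq m (re s1 * x))%A with (sq m (re s1 * x)%A) in Hy' by ring.
      pose proof (inverse_near_one_of_small _ _ Hy Hm) as N1.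
      assert (N2 : nrm B (y' - 1)%A <= 1 / 2).
      { replace (y' - 1)%A with ((y' - y) + (y - 1))%A by ring.
        eapply Rle_trans; [apply nrm_add|]. fold L in Ny.
        rewrite Rabs_pos_eq in Ny by lra. nra. }
      pose proof (small_of_inverse_near_one _ _ (1 / 2) ltac:(lra) Hy' N2) as N3.
      destruct (sq_small_of_le_one (re s1 * x)%A m (s / s1)) as [k Hk]; [|lra|].
      + split; [apply Rle_mult_inv_pos; lra|].
        apply Rmult_lt_reg_r with s1; [lra|]. unfold Rdiv. rewrite Rmult_assoc, Rinv_l by lra. lra.
      + exists k. revert Hk.
        replace (re (s / s1) * (re s1 * x))%A with (re s * x)%A; [tauto|].
        replace s with (s / s1 * s1)%R at 1 by (field; lra). rewrite re_mul. ring. }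
  (* Finitely many steps of length [d / 2] lead from 0 to [s]. *)
  assert (All : forall (j : nat) s, 0 <= s < r -> s <= INR j * (d / 2) ->
     exists m, nrm B (sq m (re s * x)%A) <= 1 / 5).
  { induction j as [|j IH]; intros s Hs Hj.
    - apply Step; [exact Hs|]. simpl in Hj. lra.
    - rewrite S_INR in Hj. apply Step; [exact Hs|]. intro Hs0. apply IH.
      + unfold Rmax; destruct Rle_dec; lra.
      + pose proof (pos_INR j). unfold Rmax; destruct Rle_dec; nra. }
  intros s Hs. destruct (INR_unbounded (s / (d / 2))) as [j Hj].
  apply (All j s Hs). apply Rmult_lt_compat_r with (r := (d / 2)%R) in Hj; [|lra].
  unfold Rdiv in Hj at 1. rewrite Rmult_assoc, Rinv_l in Hj by lra. lra.
Qed.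

(** * Elements with nonnegative spectrum *)

(** Only the spectral half of positivity: the record carries no involution. *)
Definition pos (a : B) : Prop :=
  forall z, Im z <> 0%R \/ Re z < 0 -> inv (emb B z - a)%A.

Lemma inv_sub_of_norm_lt (a : B) (r : R) : nrm B a < r -> inv (re r - a)%A.
Proof.
  intro H. pose proof (nrm_nonneg B a).
  replace (re r - a)%A with (re r * (1 - re (/ r) * a))%A.
  - apply inv_mul; [apply inv_re; lra|]. apply near_one_inv.
    eapply Rle_lt_trans; [apply nrm_re|].
    assert (0 < / r) by (apply Rinv_0_lt_compat; lra).
    assert ((r * / r = 1)%R) by (apply Rinv_r; lra).
    rewrite Rabs_pos_eq by lra. nra.
  - transitivity (re r - (re r * re (/ r)) * a)%A; [ring|]. rewrite re_inv by lra. ring.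
Qed.

Lemma pos_resolvent (a : B) (z : C) : pos a ->
  Im z <> 0%R \/ Re z < 0 \/ nrm B a < Re z -> inv (emb B z - a)%A.
Proof.
  intros Ha [H|[H|H]]; [apply Ha; tauto .. |].
  destruct (Req_dec (Im z) 0) as [E|E]; [|apply Ha; tauto].
  replace z with (RC (Re z)) by (apply C_eq; simpl; auto).
  apply inv_sub_of_norm_lt, H.
Qed.

(** The spectrum of [a] lies in [[0, M]], hence so does that of [M - a]; division by [c > M] brings
    the spectral radius below 1. *)
Lemma pos_sq_small (a : B) (M c : R) : pos a -> 0 < M -> nrm B a <= M -> M < c ->
  exists m, nrm B (sq m (re (/ c) * (re M - a))%A) <= 1 / 5.
Proof.
  intros Ha HM HaM Hc.
  (* The reciprocal of the midpoint of [M] and [c], so that [1/c < r < 1/M]. *)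
  set (r := (2 / (c + M))%R).
  assert (Hr : 0 < r) by (apply Rdiv_lt_0_compat; lra).
  assert (Hrc : (r * (c + M) = 2)%R) by (unfold r; field; lra).
  assert (Hcc : (/ c * c = 1)%R) by (apply Rinv_l; lra).
  assert (Hc0 : 0 < / c) by (apply Rinv_0_lt_compat; lra).
  apply sq_small_of_resolvent with (r := r); [exact Hr | | nra].
  intros z [Hz1 Hz2].
  destruct (classic (z = C0)) as [E|E].
  - exists 1%A. subst z. change C0 with (RC 0). rewrite re_zero. ring.
  - pose proof (Cnorm_pos z E) as Hn.
    (* Here [w = M - 1/z] and [1 - z (M - a) = - z (w - a)]. For nonreal [z] so is [w]; for real [z]
       in the square, [w] is negative if [z > 0] and exceeds [M] if [z < 0]. *)
    set (w := Cadd (RC M) (Cmul (RC (-1)) (Cinv z))).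
    replace (1 - emb B z * (re M - a))%A with (- (emb B z * (emb B w - a)))%A.
    + apply inv_opp, inv_mul; [apply inv_emb, E|]. apply pos_resolvent; [exact Ha|].
      assert (Ew : Re w = (M - Re z / (Re z * Re z + Im z * Im z))%R) by (simpl; ring).
      assert (Fw : Im w = (Im z / (Re z * Re z + Im z * Im z))%R) by (simpl; unfold Rdiv; ring).
      rewrite Ew, Fw.
      destruct (Req_dec (Im z) 0) as [F|F].
      * right. rewrite F in *. replace (Re z * Re z + 0 * 0)%R with (Re z * Re z)%R in * by ring.
        assert (Hz0 : Re z <> 0%R) by nra.
        replace (Re z / (Re z * Re z))%R with (/ Re z)%R by (field; exact Hz0).
        destruct (Rlt_or_le 0 (Re z)) as [G|G].
        -- left. rewrite Rabs_pos_eq in Hz1 by lra.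
           assert (HMr : M * Re z < 1) by nra.
           assert ((/ Re z * Re z = 1)%R) by (apply Rinv_l; lra).
           assert (0 < / Re z) by (apply Rinv_0_lt_compat; lra). nra.
        -- right. assert (/ Re z < 0) by (apply Rinv_lt_0_compat; lra). lra.
      * left. unfold Rdiv. apply Rmult_integral_contrapositive_currified; [exact F|].
        apply Rinv_neq_0_compat. lra.
    + unfold w. rewrite emb_add, emb_mul, re_neg_one.
      transitivity (emb B z * emb B (Cinv z) - emb B z * (re M - a))%A; [ring|].
      rewrite <- emb_mul, Cmul_inv, emb_one by exact E. reflexivity.
Qed.

(** * Power-bounded elements and sums *)

Fixpoint pw (p : B) (n : nat) : B :=
  match n with O => 1%A | S n => (p * pw p n)%A end.

Lemma pw_add (p : B) (m n : nat) : pw p (m + n) = (pw p m * pw p n)%A.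
Proof. induction m as [|m IH]; simpl; [|rewrite IH]; ring. Qed.

Lemma pw_two_pow (p : B) (m : nat) : pw p (2 ^ m) = sq m p.
Proof.
  induction m as [|m IH]; simpl; [ring|]. rewrite Nat.add_0_r, pw_add, IH. reflexivity.
Qed.

Lemma pw_scal (t : R) (p : B) (n : nat) : pw (re t * p)%A n = (re (t ^ n)%R * pw p n)%A.
Proof.
  induction n as [|n IH]; simpl; [rewrite re_one | rewrite IH, re_mul]; ring.
Qed.

Lemma nrm_pw (p : B) (n : nat) : nrm B (pw p n) <= (1 + nrm B p) ^ n.
Proof.
  pose proof (nrm_nonneg B p).
  induction n as [|n IH]; simpl; [apply nrm_one|].
  eapply Rle_trans; [apply nrm_mul|]. pose proof (nrm_nonneg B (pw p n)). nra.
Qed.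

(** Splitting off [n] factors at a time costs nothing, and the fewer than [n] remaining ones are
    bounded crudely. *)
Lemma power_bounded (p : B) (n : nat) : (0 < n)%nat -> nrm B (pw p n) <= 1 ->
  exists K, 0 <= K /\ forall i, nrm B (pw p i) <= K.
Proof.
  intros Hn Hp. pose proof (nrm_nonneg B p).
  exists ((1 + nrm B p) ^ n)%R. split; [apply pow_le; lra|].
  induction i as [i IH] using lt_wf_ind.
  destruct (Nat.lt_ge_cases i n) as [L|L].
  - eapply Rle_trans; [apply nrm_pw|]. apply Rle_pow; [lra | lia].
  - replace i with (n + (i - n))%nat by lia. rewrite pw_add.
    eapply Rle_trans; [apply nrm_mul|].
    specialize (IH (i - n)%nat ltac:(lia)).
    pose proof (nrm_nonneg B (pw p (i - n))). nra.
Qed.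

Lemma power_bounded_of_sq (p : B) (m : nat) : nrm B (sq m p) <= 1 / 5 ->
  exists K, 0 <= K /\ forall i, nrm B (pw p i) <= K.
Proof.
  intro H. apply power_bounded with (n := (2 ^ m)%nat).
  - pose proof (Nat.pow_nonzero 2 m). lia.
  - rewrite pw_two_pow. lra.
Qed.

(** The binomial expansion, one factor [x + y] at a time: the monomial [x^i y^k] is carried along,
    each factor doubles the bound, and no binomial coefficients appear. The case [i = k = 0] bounds
    the powers of [x + y]. *)
Lemma power_bounded_add (x y : B) (Kx Ky : R) : 0 <= Kx -> 0 <= Ky ->
  (forall i, nrm B (pw x i) <= Kx) -> (forall i, nrm B (pw y i) <= Ky) ->
  forall j i k, nrm B (pw x i * pw y k * pw (x + y)%A j)%A <= Kx * Ky * 2 ^ j.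
Proof.
  intros H1 H2 Hx Hy. induction j as [|j IH]; intros i k; simpl.
  - replace (pw x i * pw y k * 1)%A with (pw x i * pw y k)%A by ring. rewrite Rmult_1_r.
    eapply Rle_trans; [apply nrm_mul|]. apply Rmult_le_compat; auto using nrm_nonneg.
  - replace (pw x i * pw y k * ((x + y) * pw (x + y) j))%A
      with (pw x (S i) * pw y k * pw (x + y) j + pw x i * pw y (S k) * pw (x + y) j)%A
      by (simpl; ring).
    eapply Rle_trans; [apply nrm_add|].
    pose proof (IH (S i) k). pose proof (IH i (S k)). lra.
Qed.

(** [1 - p] divides [1 - p^n]. *)
Lemma inv_of_pw (p : B) (n : nat) : inv (1 - pw p n)%A -> inv (1 - p)%A.
Proof.
  intro H.
  assert (E : exists g, (1 - pw p n = (1 - p) * g)%A).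
  { clear H. induction n as [|n [g IH]]; simpl.
    - exists 0%A. ring.
    - exists (1 + p * g)%A.
      transitivity (1 - p + p * (1 - pw p n))%A; [ring | rewrite IH; ring]. }
  destruct E as [g E]. rewrite E in H. exact (inv_factor _ _ H).
Qed.

(* For [M] above the norms, [M - a] and [M - b] have spectral radius at most [M]; the spectral radius is subadditive on commuting elements. *)
Lemma inv_add_pos (a b : B) (lam : R) : pos a -> pos b -> 0 < lam ->
  inv (a + b + re lam)%A.
Proof.
  intros Ha Hb Hl.
  pose proof (nrm_nonneg B a). pose proof (nrm_nonneg B b).
  set (M := (nrm B a + nrm B b + 1)%R). set (c := (M + lam / 4)%R).
  assert (HM : 0 < M) by (unfold M; lra). assert (Hc : M < c) by (unfold c; lra).
  destruct (pos_sq_small a M c Ha HM ltac:(unfold M; lra) Hc) as [m Hm].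
  destruct (pos_sq_small b M c Hb HM ltac:(unfold M; lra) Hc) as [k Hk].
  set (X := (re (/ c) * (re M - a))%A) in *. set (Y := (re (/ c) * (re M - b))%A) in *.
  destruct (power_bounded_of_sq _ _ Hm) as (Kx & Kx0 & HKx).
  destruct (power_bounded_of_sq _ _ Hk) as (Ky & Ky0 & HKy).
  (* Since [c (X + Y) = 2 M - a - b], the sum is [d (1 - t (X + Y))]. The margin [lam / 4] in [c]
     makes [2 c < d], so the powers of [t (X + Y)], of norm at most [Kx Ky (2 t)^j], tend to 0. *)
  set (d := (2 * M + lam)%R). set (t := (c / d)%R).
  assert (Hd : 0 < d) by (unfold d; lra).
  assert (Ht : 0 < 2 * t < 1).
  { assert ((t * d = c)%R) by (unfold t; field; lra). unfold d, c in *. nra. }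
  replace (a + b + re lam)%A with (re d * (1 - re t * (X + Y)))%A.
  - apply inv_mul; [apply inv_re; lra|].
    assert (HK : 0 <= Kx * Ky) by nra.
    destruct (pow_lt_1_zero (2 * t)) with (y := (/ (Kx * Ky + 1))%R) as [j Hj];
      [rewrite Rabs_pos_eq; lra | apply Rinv_0_lt_compat; lra |].
    specialize (Hj j (le_n j)).
    apply (inv_of_pw _ j), near_one_inv. rewrite pw_scal.
    eapply Rle_lt_trans; [apply nrm_re|].
    pose proof (power_bounded_add X Y Kx Ky Kx0 Ky0 HKx HKy j 0 0) as HN.
    simpl in HN. replace (1 * 1 * pw (X + Y) j)%A with (pw (X + Y)%A j) in HN by ring.
    rewrite Rabs_pos_eq in Hj by (apply pow_le; lra).
    rewrite Rabs_pos_eq by (apply pow_le; lra).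
    rewrite Rpow_mult_distr in Hj.
    assert (0 < t ^ j) by (apply pow_lt; lra).
    assert (((Kx * Ky + 1) * / (Kx * Ky + 1) = 1)%R) by (apply Rinv_r; lra).
    assert (0 < 2 ^ j) by (apply pow_lt; lra).
    assert (H5 : t ^ j * nrm B (pw (X + Y)%A j) <= t ^ j * (Kx * Ky * 2 ^ j))
      by (apply Rmult_le_compat_l; lra).
    eapply Rle_lt_trans; [exact H5|].
    set (q := (2 ^ j * t ^ j)%R) in *.
    replace (t ^ j * (Kx * Ky * 2 ^ j))%R with (Kx * Ky * q)%R by (unfold q; ring).
    assert (0 < q) by (unfold q; apply Rmult_lt_0_compat; assumption).
    nra.
  - transitivity (re d - re d * re t * re (/ c) * (re M + re M - a - b))%A;
      [unfold X, Y; ring|].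
    rewrite <- !re_mul. replace (d * t * / c)%R with 1%R by (unfold t; field; lra).
    unfold d. replace (2 * M + lam)%R with (M + M + lam)%R by ring.
    rewrite !re_add, re_one. ring.
Qed.

(** * Products of elements with nonnegative spectrum *)

(** [a b + lam = a (b + (lam a^-1 - mu) + mu)], where the bracketed element still has nonnegative
    spectrum and [mu > 0] is the margin required for a sum. *)
Lemma inv_mul_pos_add (a b d : B) (lam : R) : pos a -> pos b -> (a * d = 1)%A -> 0 < lam ->
  inv (a * b + re lam)%A.
Proof.
  intros Ha Hb Hd Hl. pose proof (nrm_nonneg B a).
  (* The spectrum of [lam a^-1] is bounded below by [lam / |a|]; the added 1 keeps [mu] under this
     bound and avoids division by zero. *)
  set (mu := (lam / (nrm B a + 1))%R).
  assert (Hmu : 0 < mu) by (apply Rdiv_lt_0_compat; lra).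
  assert (Hmn : (mu * (nrm B a + 1) = lam)%R) by (unfold mu; field; lra).
  assert (Hp : pos (re lam * d - re mu)%A).
  { intros z Hz. set (w := Cadd z (RC mu)).
    assert (E0 : (emb B z - (re lam * d - re mu) = d * (emb B w * a - re lam))%A).
    { unfold w. rewrite emb_add.
      transitivity (a * d * (emb B z + re mu) - d * re lam)%A; [rewrite Hd; ring | ring]. }
    rewrite E0. apply inv_mul; [exists a; rewrite <- Hd; ring|].
    destruct (classic (w = C0)) as [E|E].
    - rewrite E. change C0 with (RC 0). rewrite re_zero.
      replace (0 * a - re lam)%A with (- re lam)%A by ring. apply inv_opp, inv_re. lra.
    - replace (emb B w * a - re lam)%A with (- (emb B w * (emb B (Cmul (RC lam) (Cinv w)) - a)))%A.
      + apply inv_opp, inv_mul; [apply inv_emb, E|]. apply pos_resolvent; [exact Ha|].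
        pose proof (Cnorm_pos w E) as Hn.
        assert (Rw : Re w = (Re z + mu)%R) by reflexivity.
        assert (Iw : Im w = Im z) by (simpl; ring).
        assert (Ei : Im (Cmul (RC lam) (Cinv w)) = (- (lam * Im w) / (Re w * Re w + Im w * Im w))%R)
          by (simpl; unfold Rdiv; ring).
        assert (Er : Re (Cmul (RC lam) (Cinv w)) = (lam * Re w / (Re w * Re w + Im w * Im w))%R)
          by (simpl; unfold Rdiv; ring).
        rewrite Ei, Er.
        destruct (Req_dec (Im w) 0) as [F|F].
        * right. rewrite F in *. replace (Re w * Re w + 0 * 0)%R with (Re w * Re w)%R in * by ring.
          assert (Hw0 : Re w <> 0%R) by nra.
          replace (lam * Re w / (Re w * Re w))%R with (lam * / Re w)%R by (field; exact Hw0).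
          assert (Hwm : Re w < mu) by (destruct Hz; lra).
          destruct (Rlt_or_le 0 (Re w)) as [G|G].
          -- right. assert ((/ Re w * Re w = 1)%R) by (apply Rinv_l; lra).
             assert (0 < / Re w) by (apply Rinv_0_lt_compat; lra).
             apply Rmult_lt_reg_r with (Re w); [lra|].
             rewrite Rmult_assoc, (Rmult_comm (/ Re w)), Rinv_r by lra. nra.
          -- left. assert (/ Re w < 0) by (apply Rinv_lt_0_compat; lra). nra.
        * left. unfold Rdiv. apply Rmult_integral_contrapositive_currified.
          -- apply Ropp_neq_0_compat, Rmult_integral_contrapositive_currified; [lra | exact F].
          -- apply Rinv_neq_0_compat. lra.
      + rewrite emb_mul.
        transitivity (emb B w * a - re lam * (emb B w * emb B (Cinv w)))%A; [ring|].
        rewrite <- emb_mul, Cmul_inv, emb_one by exact E. ring. }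
  replace (a * b + re lam)%A with (a * (b + (re lam * d - re mu) + re mu))%A.
  - apply inv_mul; [exists d; exact Hd|]. apply inv_add_pos; assumption.
  - transitivity (a * b + a * d * re lam)%A; [ring | rewrite Hd; ring].
Qed.

Lemma pos_add_re (a : B) (e : R) : pos a -> 0 <= e -> pos (a + re e)%A.
Proof.
  intros Ha He z Hz.
  replace (emb B z - (a + re e))%A with (emb B (Cadd z (RC (- e))) - a)%A
    by (rewrite emb_add, re_opp; ring).
  apply Ha. simpl. rewrite Rplus_0_r. destruct Hz; [tauto | right; lra].
Qed.

(** The spectrum of [b] lies in [[0, |b|]]. For [z < 0] the point [w = (l - z) / e] exceeds
    [|b|]. *)
Lemma pos_re_sub (b : B) (l e : R) : pos b -> 0 < e -> e * nrm B b < l ->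
  pos (re l - re e * b)%A.
Proof.
  intros Hb He Hl z Hz.
  set (w := Cmul (RC (/ e)) (Cadd (RC l) (Cmul (RC (-1)) z))).
  replace (emb B z - (re l - re e * b))%A with (- (re e * (emb B w - b)))%A.
  - apply inv_opp, inv_mul; [apply inv_re; lra|]. apply pos_resolvent; [exact Hb|].
    assert (He' : 0 < / e) by (apply Rinv_0_lt_compat, He).
    assert (Iw : Im w = (- (/ e * Im z))%R) by (simpl; ring).
    assert (Rw : Re w = (/ e * (l - Re z))%R) by (simpl; ring).
    rewrite Iw, Rw. destruct Hz as [Hz|Hz].
    + left. apply Ropp_neq_0_compat, Rmult_integral_contrapositive_currified; [lra | exact Hz].
    + right; right. apply Rmult_lt_reg_l with e; [exact He|].
      rewrite <- Rmult_assoc, Rinv_r by lra. lra.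
  - unfold w. rewrite emb_mul, emb_add, emb_mul, re_neg_one.
    transitivity (re e * b - re e * re (/ e) * (re l - emb B z))%A; [ring|].
    rewrite re_inv by lra. ring.
Qed.

(* With [a' = a + e] invertible, [a b + lam] is the sum of [a' b], which has nonnegative spectrum by [inv_mul_pos_add], of [lam / 2 - e b] and of [lam / 2]. *)
Lemma pos_mul (a b : B) : pos a -> pos b ->
  (forall e z, Im z <> 0%R -> inv (emb B z - (a * b + re e * b))%A) ->
  pos (a * b)%A.
Proof.
  intros Ha Hb Hreal z0 Hz0.
  destruct (Req_dec (Im z0) 0) as [E0|E0].
  2: { specialize (Hreal 0%R z0 E0). rewrite re_zero in Hreal.
       replace (a * b)%A with (a * b + 0 * b)%A by ring. exact Hreal. }
  set (lam := (- Re z0)%R).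
  assert (Hl : 0 < lam) by (unfold lam; destruct Hz0; [contradiction | lra]).
  replace (emb B z0 - a * b)%A with (- (a * b + re lam))%A.
  2: { unfold lam. rewrite re_opp. replace (RC (Re z0)) with z0 by (apply C_eq; simpl; auto). ring. }
  apply inv_opp. pose proof (nrm_nonneg B b).
  (* Chosen so that [e |b| < lam / 2]. *)
  set (e := (lam / (4 * (nrm B b + 1)))%R).
  assert (He : 0 < e) by (apply Rdiv_lt_0_compat; lra).
  assert (Hen : (e * (nrm B b + 1) = lam / 4)%R) by (unfold e; field; lra).
  assert (Ha' : pos (a + re e)%A) by (apply pos_add_re; [exact Ha | lra]).
  assert (Hinv : inv (a + re e)%A).
  { replace (a + re e)%A with (- (re (- e) - a))%A by (rewrite re_opp; ring).
    apply inv_opp, Ha. right. simpl. lra. }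
  destruct Hinv as [d Hd].
  (* Negative reals are covered by [inv_mul_pos_add], nonreal points by [Hreal]. *)
  assert (Hc : pos (a * b + re e * b)%A).
  { intros z Hz. destruct (Req_dec (Im z) 0) as [E|E]; [|apply Hreal, E].
    assert (Hz' : Re z < 0) by (destruct Hz; [contradiction | assumption]).
    replace (emb B z - (a * b + re e * b))%A with (- ((a + re e) * b + re (- Re z)))%A.
    - apply inv_opp. apply (inv_mul_pos_add _ _ d); [exact Ha' | exact Hb | exact Hd | lra].
    - rewrite re_opp. replace (RC (Re z)) with z by (apply C_eq; simpl; auto). ring. }
  replace (a * b + re lam)%A
    with ((a * b + re e * b) + (re (lam / 2) - re e * b) + re (lam / 2))%A.
  - apply inv_add_pos; [exact Hc | apply pos_re_sub; [exact Hb | exact He | nra] | lra].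
  - replace (re lam) with (re (lam / 2) + re (lam / 2))%A.
    + ring.
    + rewrite <- re_add. do 2 f_equal. lra.
Qed.

End CommutativeAlgebra.

(** * Quasi-inverses, the bicommutant and the adjoined unit *)

Section Adjunction.
Context (A : BanachStarAlgebra).

Lemma add_left_comm (x y z : A) : add A x (add A y z) = add A y (add A x z).
Proof. rewrite !add_assoc, (add_comm A x y). reflexivity. Qed.

Lemma zero_add (x : A) : add A (zero A) x = x.
Proof. rewrite add_comm. apply add_zero. Qed.

Lemma add_cancel_l (x y z : A) : add A x y = add A x z -> y = z.
Proof.
  intro H. rewrite <- (zero_add y), <- (zero_add z), <- (add_opp A x), (add_comm A x (opp A x)).
  rewrite <- !add_assoc, H. reflexivity.
Qed.

Lemma add_opp_eq (x y z : A) : add A x (opp A y) = z <-> x = add A z y.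
Proof.
  split; intro H.
  - rewrite <- H, <- add_assoc, (add_comm A (opp A y)), add_opp, add_zero. reflexivity.
  - rewrite H, <- add_assoc, add_opp, add_zero. reflexivity.
Qed.

Lemma scal_C0 (x : A) : scal A C0 x = zero A.
Proof.
  apply (add_cancel_l (scal A C0 x)). rewrite <- scal_distr_r, add_zero. f_equal. C_ring.
Qed.

Lemma scal_zero (z : C) : scal A z (zero A) = zero A.
Proof.
  apply (add_cancel_l (scal A z (zero A))). rewrite <- scal_distr_l, !add_zero. reflexivity.
Qed.

Lemma mul_zero_l (x : A) : mul A (zero A) x = zero A.
Proof.
  apply (add_cancel_l (mul A (zero A) x)). rewrite <- mul_add_l, !add_zero. reflexivity.
Qed.

Lemma mul_zero_r (x : A) : mul A x (zero A) = zero A.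
Proof.
  apply (add_cancel_l (mul A x (zero A))). rewrite <- mul_add_r, !add_zero. reflexivity.
Qed.

Lemma opp_scal (x : A) : opp A x = scal A (RC (-1)) x.
Proof.
  apply (add_cancel_l x). rewrite add_opp. rewrite <- (scal_one A x) at 1.
  rewrite <- scal_distr_r, <- (scal_C0 x). f_equal. C_ring.
Qed.

Lemma mul_opp_l (x y : A) : mul A (opp A x) y = opp A (mul A x y).
Proof. rewrite !opp_scal, mul_scal_l. reflexivity. Qed.

Lemma mul_opp_r (x y : A) : mul A x (opp A y) = opp A (mul A x y).
Proof. rewrite !opp_scal, mul_scal_r. reflexivity. Qed.

Lemma scal_opp (z : C) (x : A) : scal A z (opp A x) = opp A (scal A z x).
Proof. rewrite !opp_scal, !scal_assoc. f_equal. C_ring. Qed.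

Lemma norm_zero : norm A (zero A) = 0.
Proof.
  rewrite <- (scal_C0 (zero A)), norm_scal. change C0 with (RC 0).
  rewrite Cmod_RC, Rabs_R0. ring.
Qed.

Lemma norm_opp (x : A) : norm A (opp A x) = norm A x.
Proof. rewrite opp_scal, norm_scal, Cmod_RC, Rabs_neg_one. ring. Qed.

Lemma sub_zero_eq (x y : A) : sub A x y = zero A -> x = y.
Proof. intro H. apply add_opp_eq in H. rewrite zero_add in H. exact H. Qed.

Lemma mul_sub_r (x y z : A) : mul A x (sub A y z) = sub A (mul A x y) (mul A x z).
Proof. unfold sub. rewrite mul_add_r, mul_opp_r. reflexivity. Qed.

Lemma norm_sub_triangle (x y z : A) :
  norm A (sub A x z) <= norm A (sub A x y) + norm A (sub A y z).
Proof.
  replace (sub A x z) with (add A (sub A x y) (sub A y z)); [apply norm_triangle|].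
  unfold sub. rewrite <- add_assoc. f_equal.
  rewrite add_assoc, (add_comm A (opp A y)), add_opp. apply zero_add.
Qed.

Lemma norm_sub_comm (x y : A) : norm A (sub A x y) = norm A (sub A y x).
Proof.
  rewrite <- norm_opp. f_equal. unfold sub.
  rewrite opp_scal, scal_distr_l, <- !opp_scal, add_comm. f_equal.
  rewrite !opp_scal, scal_assoc. rewrite <- (scal_one A y) at 2. f_equal. C_ring.
Qed.

Lemma sub_add_cancel (x y z : A) : sub A (add A x y) (add A x z) = sub A y z.
Proof.
  apply add_opp_eq. rewrite add_left_comm. f_equal. apply add_opp_eq. reflexivity.
Qed.

Lemma zero_of_contraction (x d : A) : norm A x < 1 -> d = mul A x d -> d = zero A.
Proof.
  intros Hx Hd. apply norm_eq0. pose proof (norm_mul A x d) as H. rewrite <- Hd in H.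
  pose proof (norm_nonneg A d). nra.
Qed.

(** [y] is the sum of [x + x^2 + x^3 + ...], so that [1 + y] plays the part of the inverse of
    [1 - x] without a unit. *)
Lemma quasi_inverse_of_small (x : A) : norm A x < 1 ->
  exists y, y = add A x (mul A x y).
Proof.
  intro Hx. pose proof (norm_nonneg A x) as Hx0. set (q := norm A x) in *.
  pose (s := fix s n := match n with O => zero A | S n => add A x (mul A x (s n)) end).
  (* The geometric sum, fixed by [D = q + q D], bounds every partial sum. *)
  set (D := q / (1 - q)).
  assert (HD : q + q * D = D) by (unfold D; field; lra).
  assert (HD0 : 0 <= D) by (apply Rle_mult_inv_pos; lra).
  assert (Bd : forall n, norm A (s n) <= D).
  { induction n as [|n IH]; simpl; [rewrite norm_zero; exact HD0|].
    eapply Rle_trans; [apply norm_triangle|]. pose proof (norm_mul A x (s n)) as H. fold q in H |- *. nra. }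
  assert (Tail : forall m k, norm A (sub A (s (m + k)%nat) (s m)) <= q ^ m * D).
  { induction m as [|m IH]; intro k.
    - simpl. unfold sub. replace (opp A (zero A)) with (zero A)
        by (rewrite opp_scal, scal_zero; reflexivity).
      rewrite add_zero, Rmult_1_l. apply Bd.
    - simpl. rewrite sub_add_cancel, <- mul_sub_r.
      eapply Rle_trans; [apply norm_mul|]. fold q. specialize (IH k). nra. }
  destruct (complete A s) as [y Hy].
  { intros eps He. destruct (pow_lt_1_zero q) with (y := eps / (D + 1)) as [N HN].
    - rewrite Rabs_pos_eq; lra.
    - apply Rdiv_lt_0_compat; lra.
    - assert (HN' : forall m, (N <= m)%nat -> q ^ m * D < eps).
      { intros m Hm. specialize (HN m Hm). rewrite Rabs_pos_eq in HN by (apply pow_le, Hx0).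
        pose proof (pow_le q m Hx0).
        apply Rmult_lt_compat_r with (r := D + 1) in HN; [|lra].
        unfold Rdiv in HN. rewrite Rmult_assoc, Rinv_l in HN by lra. nra. }
      exists N. intros m n Hm Hn. fold (sub A (s m) (s n)).
      destruct (Nat.le_ge_cases m n) as [L|L].
      + rewrite norm_sub_comm. replace n with (m + (n - m))%nat by lia.
        eapply Rle_lt_trans; [apply Tail | apply HN', Hm].
      + replace m with (n + (m - n))%nat by lia.
        eapply Rle_lt_trans; [apply Tail | apply HN', Hn]. }
  (* The limit satisfies the equation because [s (S N) = x + x s N] and both partial sums are close
     to [y]. *)
  exists y. apply sub_zero_eq, norm_eq0.
  apply Rle_antisym; [|apply norm_nonneg]. apply le_epsilon. intros eps He.
  destruct (Hy (eps / 2) ltac:(lra)) as [N HN].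
  pose proof (HN N (le_n N)) as H0. pose proof (HN (S N) (le_S _ _ (le_n N))) as H1.
  fold (sub A (s N) y) in H0. fold (sub A (s (S N)) y) in H1.
  pose proof (norm_sub_triangle y (s (S N)) (add A x (mul A x y))) as H2.
  rewrite (norm_sub_comm y (s (S N))) in H2.
  replace (sub A (s (S N)) (add A x (mul A x y))) with (mul A x (sub A (s N) y)) in H2
    by (simpl; rewrite sub_add_cancel, <- mul_sub_r; reflexivity).
  pose proof (norm_mul A x (sub A (s N) y)) as H3. fold q in H3.
  pose proof (norm_nonneg A (sub A (s N) y)). nra.
Qed.

(** Write the inverse of [z - x] as [1/z + y]. The equations for [y] mention no unit, so the unital
    and nonunital cases get a common form. *)
Lemma tilde_invertible_iff (z : C) (x : A) : z <> C0 ->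
  tilde_invertible A z x <->
  exists y, scal A z y = add A (scal A (Cinv z) x) (mul A x y) /\
            scal A z y = add A (scal A (Cinv z) x) (mul A y x).
Proof.
  intro Hz. pose proof (Cmul_inv z Hz) as Hi. split.
  - intros [(e & He & b & H1 & H2) | (_ & mu & b & Hm & H1 & H2)].
    + unfold sub in H1, H2. rewrite mul_add_l, mul_opp_l, mul_scal_l, (proj1 (He b)) in H1.
      rewrite mul_add_r, mul_opp_r, mul_scal_r, (proj2 (He b)) in H2.
      apply (proj1 (add_opp_eq _ _ _)) in H1; apply (proj1 (add_opp_eq _ _ _)) in H2.
      exists (add A b (opp A (scal A (Cinv z) e))).
      rewrite scal_distr_l, scal_opp, scal_assoc, Hi, scal_one, mul_add_r, mul_add_l,
        mul_opp_r, mul_opp_l, mul_scal_r, mul_scal_l, (proj1 (He x)), (proj2 (He x)).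
      split; apply add_opp_eq; [rewrite H1 | rewrite H2];
        rewrite (add_comm A e); f_equal;
        rewrite add_comm; apply add_opp_eq; reflexivity.
    + assert (Em : mu = Cinv z).
      { transitivity (Cmul (Cmul z (Cinv z)) mu); [rewrite Hi; C_ring|].
        transitivity (Cmul (Cmul z mu) (Cinv z)); [C_ring | rewrite Hm; C_ring]. }
      subst mu. exists b. rewrite mul_opp_l, scal_opp in H1. rewrite mul_opp_r, scal_opp in H2.
      apply (proj1 (add_opp_eq _ _ _)) in H1. apply (proj1 (add_opp_eq _ _ _)) in H1. rewrite zero_add, add_comm in H1.
      apply (proj1 (add_opp_eq _ _ _)) in H2. rewrite zero_add, add_comm in H2. apply (proj1 (add_opp_eq _ _ _)) in H2.
      rewrite add_comm in H2. split; assumption.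
  - intros (y & H1 & H2). destruct (classic (unital A)) as [[e He]|Hu].
    + left. exists e. split; [exact He|]. exists (add A y (scal A (Cinv z) e)).
      assert (Ez : scal A z (add A y (scal A (Cinv z) e)) = add A e (scal A z y))
        by (rewrite scal_distr_l, scal_assoc, Hi, scal_one; apply add_comm).
      unfold sub. split.
      * rewrite mul_add_l, mul_opp_l, mul_scal_l, (proj1 (He _)).
        apply (proj2 (add_opp_eq _ _ _)). rewrite Ez. f_equal.
        rewrite H1, mul_add_r, mul_scal_r, (proj2 (He x)). apply add_comm.
      * rewrite mul_add_r, mul_opp_r, mul_scal_r, (proj2 (He _)).
        apply (proj2 (add_opp_eq _ _ _)). rewrite Ez. f_equal.
        rewrite H2, mul_add_l, mul_scal_l, (proj1 (He x)). apply add_comm.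
    + right. split; [exact Hu|]. exists (Cinv z), y. split; [exact Hi|].
      rewrite mul_opp_l, mul_opp_r, scal_opp. split.
      * do 2 apply (proj2 (add_opp_eq _ _ _)). rewrite zero_add, add_comm. exact H1.
      * apply (proj2 (add_opp_eq _ _ _)). rewrite zero_add, add_comm.
        apply (proj2 (add_opp_eq _ _ _)). rewrite add_comm. exact H2.
Qed.

Context (a b : A) (Hab : mul A a b = mul A b a).

(** Preferred to the subalgebra generated by [a] and [b] because it contains inverses without any
    closure argument. *)
Definition bicommutant (x : A) : Prop := forall w,
  mul A w a = mul A a w -> mul A w b = mul A b w -> mul A x w = mul A w x.

(** As [a] and [b] commute, each may serve as [w] for [y]; hence [y] commutes with both and may
    serve as [w] for [x]. *)
Lemma bicommutant_comm (x y : A) : bicommutant x -> bicommutant y -> mul A x y = mul A y x.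
Proof.
  intros Hx Hy. apply Hx; apply Hy; auto.
Qed.

Lemma bicommutant_l : bicommutant a.
Proof. intros w H _. auto. Qed.

Lemma bicommutant_r : bicommutant b.
Proof. intros w _ H. auto. Qed.

Lemma bicommutant_zero : bicommutant (zero A).
Proof. intros w _ _. rewrite mul_zero_l, mul_zero_r. reflexivity. Qed.

Lemma bicommutant_add (x y : A) : bicommutant x -> bicommutant y -> bicommutant (add A x y).
Proof. intros Hx Hy w Ha Hb. rewrite mul_add_l, mul_add_r, Hx, Hy by assumption. reflexivity. Qed.

Lemma bicommutant_scal (z : C) (x : A) : bicommutant x -> bicommutant (scal A z x).
Proof. intros Hx w Ha Hb. rewrite mul_scal_l, mul_scal_r, Hx by assumption. reflexivity. Qed.

Lemma bicommutant_opp (x : A) : bicommutant x -> bicommutant (opp A x).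
Proof. rewrite opp_scal. apply bicommutant_scal. Qed.

Lemma bicommutant_mul (x y : A) : bicommutant x -> bicommutant y -> bicommutant (mul A x y).
Proof.
  intros Hx Hy w Ha Hb. rewrite <- mul_assoc, Hy, mul_assoc, Hx, mul_assoc by assumption.
  reflexivity.
Qed.

(** The commutator [d = y w - w y] satisfies [d = x d], and [|x| < 1]. *)
Lemma bicommutant_quasi_inverse_of_small (x y : A) : norm A x < 1 -> bicommutant x ->
  y = add A x (mul A x y) -> bicommutant y.
Proof.
  intros Hx Bx Hy w Ha Hb. apply sub_zero_eq, (zero_of_contraction x); [exact Hx|].
  rewrite mul_sub_r, (mul_assoc A x w y), (Bx w Ha Hb), <- (mul_assoc A w x y).
  rewrite Hy at 1 2. rewrite mul_add_l, mul_add_r, (Bx w Ha Hb), sub_add_cancel, <- mul_assoc.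
  reflexivity.
Qed.

(** The first equation gives [z d = x d] for the commutator [d = y w - w y]. The second, multiplied
    by [d], then reads [z y d = d + z y d], so [d = 0]. *)
Lemma bicommutant_quasi_inverse (z : C) (x y : A) : z <> C0 -> bicommutant x ->
  scal A z y = add A (scal A (Cinv z) x) (mul A x y) ->
  scal A z y = add A (scal A (Cinv z) x) (mul A y x) -> bicommutant y.
Proof.
  intros Hz Bx H1 H2 w Ha Hb. apply sub_zero_eq. set (d := sub A (mul A y w) (mul A w y)).
  assert (E : scal A z d = mul A x d).
  { unfold d. rewrite mul_sub_r, (mul_assoc A x w y), (Bx w Ha Hb), <- (mul_assoc A w x y).
    unfold sub at 1. rewrite scal_distr_l, scal_opp, <- mul_scal_l, <- mul_scal_r, H1.
    rewrite mul_add_l, mul_add_r, mul_scal_l, mul_scal_r, (Bx w Ha Hb), <- (mul_assoc A x y w).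
    apply sub_add_cancel. }
  assert (F : mul A (scal A z y) d = add A (scal A (Cinv z) (mul A x d)) (mul A y (mul A x d))).
  { rewrite H2, mul_add_l, mul_scal_l, mul_assoc. reflexivity. }
  rewrite <- E, mul_scal_l, mul_scal_r, scal_assoc in F.
  replace (Cmul (Cinv z) z) with C1 in F by (rewrite <- (Cmul_inv z Hz); C_ring).
  rewrite scal_one in F. symmetry. apply (add_cancel_l (scal A z (mul A y d))).
  rewrite add_zero, add_comm. exact F.
Qed.

(* A unit is adjoined even when [A] has one: for [z <> 0] the invertibility of [z - x] is the same in both algebras. *)
Record adjoined := Adj { adj_scal : C; adj_elt : A; adj_bicomm : bicommutant adj_elt }.

Lemma adj_eq (p q : adjoined) : adj_scal p = adj_scal q -> adj_elt p = adj_elt q -> p = q.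
Proof.
  destruct p as [l x Hx], q as [m y Hy]; simpl; intros; subst. f_equal. apply proof_irrelevance.
Qed.

Definition adj_add (p q : adjoined) : adjoined :=
  Adj (Cadd (adj_scal p) (adj_scal q)) (add A (adj_elt p) (adj_elt q))
    (bicommutant_add _ _ (adj_bicomm p) (adj_bicomm q)).

Definition adj_opp (p : adjoined) : adjoined :=
  Adj (Copp (adj_scal p)) (opp A (adj_elt p)) (bicommutant_opp _ (adj_bicomm p)).

Definition adj_mul (p q : adjoined) : adjoined :=
  Adj (Cmul (adj_scal p) (adj_scal q))
    (add A (add A (scal A (adj_scal p) (adj_elt q)) (scal A (adj_scal q) (adj_elt p)))
       (mul A (adj_elt p) (adj_elt q)))
    (bicommutant_add _ _
       (bicommutant_add _ _ (bicommutant_scal _ _ (adj_bicomm q))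
          (bicommutant_scal _ _ (adj_bicomm p)))
       (bicommutant_mul _ _ (adj_bicomm p) (adj_bicomm q))).

Definition adj_emb (z : C) : adjoined := Adj z (zero A) bicommutant_zero.

Definition adj_norm (p : adjoined) : R := Cmod (adj_scal p) + norm A (adj_elt p).

(** Moves the summand [t] to the head of the right side; [sum_perm] uses it to match two sums term
    by term. *)
Ltac front t := repeat match goal with
  | |- _ = ?R => match R with
    | context [add A ?y (add A t ?s)] => tryif constr_eq y t then fail else rewrite (add_left_comm y t s)
    | context [add A ?y t] => tryif constr_eq y t then fail else rewrite (add_comm A y t)
    end
  end.

Ltac sum_perm := rewrite <- ?add_assoc; repeat match goal with
  | |- ?u = ?u => reflexivity
  | |- add A ?t _ = _ => front t; f_equal
  end.

Lemma adj_ring : ring_theory (adj_emb C0) (adj_emb C1) adj_add adj_mul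
  (fun p q => adj_add p (adj_opp q)) adj_opp eq.
Proof.
  constructor; intros; apply adj_eq; simpl; try C_ring.
  - apply zero_add.
  - apply add_comm.
  - apply add_assoc.
  - rewrite scal_one, scal_zero, mul_zero_l, !add_zero. reflexivity.
  - rewrite (add_comm A (scal A _ _)), (bicommutant_comm _ _ (adj_bicomm x) (adj_bicomm y)).
    reflexivity.
  - rewrite !scal_distr_l, !mul_add_l, !mul_add_r, !mul_scal_l, !mul_scal_r, !scal_assoc, mul_assoc.
    set (l := adj_scal x); set (m := adj_scal y); set (n := adj_scal z).
    replace (Cmul n l) with (Cmul l n) by C_ring.
    replace (Cmul n m) with (Cmul m n) by C_ring. sum_perm.
  - rewrite !scal_distr_l, !scal_distr_r, !mul_add_l. sum_perm.
  - reflexivity.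
  - apply add_opp.
Qed.

(** With [p = l + x] and [nu = 1 - l], factor [1 - p = nu (1 - x / nu)]; here
    [|x| < 1 - |l| <= |nu|], so [x / nu] has a quasi-inverse. *)
Lemma adj_near_one_inv (p : adjoined) : adj_norm p < 1 ->
  exists q, adj_mul (adj_add (adj_emb C1) (adj_opp p)) q = adj_emb C1.
Proof.
  destruct p as [l x Hx]. unfold adj_norm; simpl. intro Hn.
  set (nu := Cadd C1 (Copp l)).
  pose proof (norm_nonneg A x) as Nx. pose proof (Cmod_nonneg l) as Nl.
  assert (Nu : 1 - Cmod l <= Cmod nu).
  { pose proof (Cmod_add nu l) as H. replace (Cadd nu l) with (RC 1) in H by (unfold nu; C_ring).
    rewrite Cmod_RC, Rabs_R1 in H. lra. }
  assert (Hnu : nu <> C0).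
  { intro E. rewrite E in Nu. change C0 with (RC 0) in Nu. rewrite Cmod_RC, Rabs_R0 in Nu. lra. }
  pose proof (Cmul_inv nu Hnu) as Hi.
  assert (Ni : Cmod nu * Cmod (Cinv nu) = 1).
  { rewrite <- Cmod_mul, Hi. change C1 with (RC 1). rewrite Cmod_RC. apply Rabs_R1. }
  pose proof (Cmod_nonneg (Cinv nu)) as Ni0.
  set (x' := scal A (Cinv nu) x).
  assert (Nx' : norm A x' < 1) by (unfold x'; rewrite norm_scal; nra).
  destruct (quasi_inverse_of_small x' Nx') as [y Hy].
  assert (By : bicommutant y).
  { apply (bicommutant_quasi_inverse_of_small x'); [exact Nx' | | exact Hy].
    apply bicommutant_scal, Hx. }
  exists (Adj (Cinv nu) (scal A (Cinv nu) y) (bicommutant_scal _ _ By)).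
  apply adj_eq; simpl; [exact Hi|]. fold nu.
  rewrite scal_assoc, Hi, scal_one, zero_add, mul_opp_l, scal_opp, mul_scal_r, <- mul_scal_l.
  do 2 apply (proj2 (add_opp_eq _ _ _)). rewrite zero_add, add_comm. exact Hy.
Qed.

Definition adjoined_algebra : InvNormedAlgebra.
Proof.
  refine {| alg_ring := adj_ring; emb := adj_emb; emb_one := eq_refl; nrm := adj_norm;
            near_one_inv := adj_near_one_inv |}; unfold adj_norm; simpl.
  - intros z w. apply adj_eq; simpl; [reflexivity | rewrite add_zero; reflexivity].
  - intros z w. apply adj_eq; simpl; [reflexivity|].
    rewrite !scal_zero, mul_zero_l, !add_zero. reflexivity.
  - intro x. pose proof (norm_nonneg A (adj_elt x)). pose proof (Cmod_nonneg (adj_scal x)). lra.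
  - rewrite norm_zero. change C1 with (RC 1). rewrite Cmod_RC, Rabs_R1. lra.
  - intros x y. pose proof (norm_triangle A (adj_elt x) (adj_elt y)).
    pose proof (Cmod_add (adj_scal x) (adj_scal y)). lra.
  - intros [l x Hx] [m y Hy]; simpl. rewrite Cmod_mul.
    pose proof (norm_triangle A (add A (scal A l y) (scal A m x)) (mul A x y)).
    pose proof (norm_triangle A (scal A l y) (scal A m x)).
    pose proof (norm_mul A x y). rewrite !norm_scal in *. lra.
  - intros z [l x Hx]; simpl. rewrite Cmod_mul, mul_zero_l, scal_zero, !add_zero, norm_scal. lra.
Defined.

Definition adj_in (x : A) (Hx : bicommutant x) : adjoined_algebra := Adj C0 x Hx.

(** Spectral permanence away from 0: any inverse has scalar part [1/z], and its part in [A] lies in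
    the bicommutant. *)
Lemma tilde_invertible_iff_inv (z : C) (x : A) (Hx : bicommutant x) : z <> C0 ->
  tilde_invertible A z x <->
  inv adjoined_algebra (rsub adjoined_algebra (emb adjoined_algebra z) (adj_in x Hx)).
Proof.
  intro Hz. pose proof (Cmul_inv z Hz) as Hi. rewrite tilde_invertible_iff by exact Hz. split.
  - intros (y & H1 & H2).
    exists (Adj (Cinv z) y (bicommutant_quasi_inverse z x y Hz Hx H1 H2)).
    apply adj_eq; simpl; replace (Cadd z (Copp C0)) with z by C_ring; [exact Hi|].
    rewrite zero_add, mul_opp_l, scal_opp. do 2 apply (proj2 (add_opp_eq _ _ _)).
    rewrite zero_add, add_comm. exact H1.
  - intros [[m y Hy] E].
    pose proof (f_equal adj_scal E) as E1. pose proof (f_equal adj_elt E) as E2. simpl in E1, E2.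
    replace (Cadd z (Copp C0)) with z in E1, E2 by C_ring.
    rewrite zero_add, mul_opp_l, scal_opp in E2. do 2 apply (proj1 (add_opp_eq _ _ _)) in E2.
    rewrite zero_add, add_comm in E2.
    assert (Em : m = Cinv z).
    { transitivity (Cmul (Cmul z (Cinv z)) m); [rewrite Hi; C_ring|].
      transitivity (Cmul (Cmul z m) (Cinv z)); [C_ring | rewrite E1; C_ring]. }
    subst m. exists y. split; [exact E2|].
    rewrite (bicommutant_comm _ _ Hy Hx). exact E2.
Qed.

End Adjunction.

(** * Transfer to the Hermitian algebra *)

Theorem theorem17p5 (A : BanachStarAlgebra) (HA : hermitian_algebra A)
  (a b : A) (Ha : positive_elem A a) (Hb : positive_elem A b) :
  positive_elem A (mul A a b) <-> mul A a b = mul A b a.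
Proof.
  destruct Ha as [Sa Pa], Hb as [Sb Pb]. unfold hermitian_elem in Sa, Sb. split.
  - intros [H _]. unfold hermitian_elem in H. rewrite star_mul, Sa, Sb in H. auto.
  - intro Hab.
    assert (Hh : hermitian_elem A (mul A a b)).
    { unfold hermitian_elem. rewrite star_mul, Sa, Sb. auto. }
    split; [exact Hh|]. intros lam Hlam. pose proof (HA _ Hh _ Hlam) as Hreal.
    split; [exact Hreal|]. apply Rnot_lt_le. intro Hneg. apply Hlam.
    assert (Ba := bicommutant_l A a b). assert (Bb := bicommutant_r A a b).
    set (B := adjoined_algebra A a b Hab).
    (* Only points off [[0, oo)] are tested, so 0, where adjoining a unit may change the spectrum,
       never occurs. *)
    assert (nz : forall z : C, Im z <> 0 \/ Re z < 0 -> z <> C0).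
    { intros z Hz E. rewrite E in Hz. simpl in Hz. destruct Hz; [congruence | lra]. }
    assert (POS : forall x (Bx : bicommutant A a b x),
      (forall l, in_spectrum A x l -> Im l = 0 /\ 0 <= Re l) -> pos B (adj_in A a b Hab x Bx)).
    { intros x Bx Px z Hz. apply tilde_invertible_iff_inv; [apply nz, Hz|].
      apply NNPP. intro Hn. destruct (Px z Hn). destruct Hz; [contradiction | lra]. }
    apply (tilde_invertible_iff_inv A a b Hab lam _ (bicommutant_mul A a b _ _ Ba Bb));
      [apply nz; tauto|]. fold B.
    assert (Eab : adj_in A a b Hab _ (bicommutant_mul A a b _ _ Ba Bb)
      = rmul B (adj_in A a b Hab a Ba) (adj_in A a b Hab b Bb)).
    { apply adj_eq; simpl; [C_ring | rewrite !scal_C0, !zero_add; reflexivity]. }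
    rewrite Eab.
    apply pos_mul; [apply POS, Pa | apply POS, Pb | | right; exact Hneg].
    (* [a b + e b] is Hermitian because [a] and [b] commute and [e] is real, so its spectrum is
       real. *)
    intros e z Hz.
    assert (Bc := bicommutant_add A a b _ _ (bicommutant_mul A a b _ _ Ba Bb)
      (bicommutant_scal A a b (RC e) _ Bb)).
    assert (Ec : radd B (rmul B (adj_in A a b Hab a Ba) (adj_in A a b Hab b Bb))
      (rmul B (emb B (RC e)) (adj_in A a b Hab b Bb)) = adj_in A a b Hab _ Bc).
    { apply adj_eq; simpl; [C_ring|].
      rewrite !scal_C0, mul_zero_l, !zero_add, !add_zero. reflexivity. }
    rewrite Ec. apply tilde_invertible_iff_inv; [apply nz; tauto|].
    apply NNPP. intro Hn. apply Hz. apply (HA _) in Hn; [exact Hn|].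
    unfold hermitian_elem. rewrite star_add, star_scal, star_mul, Sa, Sb, <- Hab.
    do 2 f_equal. C_ring.
Qed.
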